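(* Let $(S,M)$ be a marked surface, $T$ a tagged triangulation satisfying (A1), $\delta$ a tagged arc with $\overline\delta\notin T$ satisfying (A2), and let $B_\delta$ be the bipartite graph associated with $T_\delta$, with minimal matching $E_-(B_\delta)$. For every perfect matching $E$ of $B_\delta$, the symmetric difference $E_-(B_{\delta})\triangle E$ consists of all boundary edges of some (possibly empty or disconnected) subgraph $B_E$ of $B_{\delta}$ that is a union of squares.
   Context: Surface setting. A marked surface $(S,M)$: $S$ is a connected compact oriented Riemann surface with possibly empty boundary, $M\subset S$ a non-empty finite set with at least one point on each boundary component; punctures are the points of $M$ in the interior. Excluded: a monogon with at most one puncture, an unpunctured digon or triangle, a sphere with at most three punctures. Arcs, ideal triangulations, tagged arcs and tagged triangulations are in the sense of Fomin–Shapiro–Thurston; if $S$ is closed with exactly one puncture, all tagged arcs are plain. $\overline\delta$ is the plain arc underlying $\delta$; for a plain arc $\gamma$ with endpoints $p,q$, $\gamma^{(p)}$ is $\gamma$ notched at $p$ and $\gamma^{(pq)}$ is $\gamma$ notched at both ends. (A1) $T$ consists of plain and 1-notched arcs, and for each puncture at most one 1-notched arc of $T$ has its notched end there. (A2) No 1-notched arc of $T$ has its notched end at a puncture where $\delta$ is notched. $T^0$ is the ideal triangulation obtained from $T$ by replacing every 1-notched arc (plain at $o$, notched at $r$) by the loop at $o$ around it cutting out a monogon containing only the puncture $r$. Polygon $T_\delta$. Let $\gamma=\overline\delta$, oriented from $q$ to $p$; $\tau_1,\dots,\tau_n$ the arcs of $T^0$ crossed by $\gamma$ in order, $\triangle_0,\dots,\triangle_n$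 the triangles passed through. $T_\gamma$ is the triangulated $(n+3)$-gon obtained from copies of $\triangle_0,\dots,\triangle_n$ (a self-folded triangle is cut open along its radius) by gluing the copies of $\triangle_{i-1},\triangle_i$ along $\tau_i$. $T_{\gamma^{(p)}}$ is obtained from $T_\gamma$ by gluing on copies of triangles, one for each corner at $p$ of a triangle of $T^0$ other than the corner through which $\gamma$ reaches $p$, cyclically around $p$ as in the surface, so that $p$ becomes an interior vertex (puncture) of a triangulated polygon; $T_{\gamma^{(pq)}}$: the same at both ends. Gluing edges are diagonals, other edges boundary segments. A perfect matching of angles in $T_\delta$ is a set of angles of its triangles containing exactly one angle at each vertex incident to at least one diagonal and exactly one angle of each triangle. The minimal matching $A_-(T_\delta)$ is the unique perfect matching of angles such that at each boundary vertex $v$ incident to a diagonal its angle at $v$ comes first in counterclockwise order around $v$. $B_\delta$: black vertices are the vertices of $T_\delta$ incident to at least one diagonal, white vertices are the triangles of $T_\delta$; each triangle is joined to those of its vertices that are black. $B_\delta$ is drawn in the plane inside $T_\delta$. $\varpi$ is the bijection from angles of $T_\delta$ incident to at least one diagonal, equivalently (as in the paper) from (vertex, triangle) corners at black vertices, to edges of $B_\delta$: the angle at $v$ in triangle $\triangle$ goes to the edge $v\triangle$. $E_-(B_\delta):=\varpi(A_-(T_\delta))$, a perfect matching of $B_\delta$. For each diagonal $\tau$ of $T_\delta$ the square labelled $\tau$ is the 4-cycle face of $B_\delta$ whose white vertices are the two triangles containing $\tau$ and whose black vertices are the endpoints of $\tau$. For a union of squares, a boundary edge is an edge belonging to exactly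 one of these squares. $X\triangle X'$ for sets denotes $(X\cup X')\setminus(X\cap X')$. *)

(* Defs.v *)
From HB Require Import structures.
From mathcomp Require Import all_boot all_order all_algebra.
From mathcomp Require Import complex.
From mathcomp Require Import all_classical all_reals all_analysis.
Set Implicit Arguments.
Unset Strict Implicit.
Unset Printing Implicit Defensive.
Import Order.TTheory GRing.Theory Num.Theory numFieldNormedType.Exports.
Local Open Scope ring_scope.

(* Triangles have vertices 0, 1, 2 in counterclockwise order, with indices in
   the additive group 'I_3.  For a triangle t, the pair (t, v) denotes the
   corner of t at vertex v when used as a corner, and the side of t opposite to
   v, running from v + 1 to v + 2, when used as a side.  Thus the corner (t, v)
   lies between the sides (t, v + 2) (clockwise) and (t, v + 1)
   (counterclockwise).  Glued sides are always identified with reversed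
   direction, so that the orientations of the triangles agree. *)


Record tri_complex := TriComplex {
  tri :> finType;
  glued : rel (tri * 'I_3)
}.

Section Matchings.
Variable P : tri_complex.
Implicit Types (x y d : P * 'I_3) (v : {set P * 'I_3}) (A : {set P * 'I_3}).

Definition cw_side x : P * 'I_3 := (x.1, x.2 + 2).
Definition ccw_side x : P * 'I_3 := (x.1, x.2 + 1).

Definition is_diagonal d := [exists d', glued d d' || glued d' d].

(* A glued pair d, d' identifies the start of d with the end of d', and the end
   of d with the start of d'. *)
Definition identified x y :=
  [exists d, exists d', (glued d d' || glued d' d) &&
    ((x == (d.1, d.2 + 1)) && (y == (d'.1, d'.2 + 2)) ||
     (x == (d.1, d.2 + 2)) && (y == (d'.1, d'.2 + 1)))].

(* A vertex is represented by the set of all corners located at it. *)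
Definition vertex x : {set P * 'I_3} := [set y | connect identified x y]%SET.
Definition vertices : {set {set P * 'I_3}} := [set vertex x | x : P * 'I_3]%SET.

Definition black_vertices : {set {set P * 'I_3}} :=
  [set v in vertices |
    [exists x in v, is_diagonal (cw_side x) || is_diagonal (ccw_side x)]]%SET.

Definition boundary_vertex v :=
  [exists x in v, ~~ is_diagonal (cw_side x) || ~~ is_diagonal (ccw_side x)].

(* y immediately follows x counterclockwise around their common vertex. *)
Definition ccw_next x y :=
  glued (ccw_side x) (cw_side y) || glued (cw_side y) (ccw_side x).

Definition angle_matching A : Prop :=
  (forall v, v \in black_vertices -> #|A :&: v| = 1%N) /\
  (forall t : P, #|[set x in A | x.1 == t]%SET| = 1%N).

Definition minimal_angle_matching A : Prop :=
  angle_matching A /\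
  forall v, v \in black_vertices -> boundary_vertex v ->
    forall x, x \in A :&: v -> forall y, y \in v -> ~~ ccw_next y x.


(* An edge of the graph is a pair (black vertex, white vertex). *)
Definition bedge : finType := ({set P * 'I_3} * P)%type.

Definition graph_edges : {set bedge} :=
  [set e : bedge |
    (e.1 \in black_vertices) && [exists x in e.1, x.1 == e.2]]%SET.

Definition perfect_matching (E : {set bedge}) : Prop :=
  [/\ E \subset graph_edges,
      forall v, v \in black_vertices -> #|[set e in E | e.1 == v]%SET| = 1%N &
      forall t : P, #|[set e in E | e.2 == t]%SET| = 1%N].

Definition varpi x : bedge := (vertex x, x.1).

Definition matching_of_angles A : {set bedge} :=
  [set varpi x | x in A & vertex x \in black_vertices]%SET.

Definition square d d' : {set bedge} :=
  finset.setX [set vertex (d.1, d.2 + 1); vertex (d.1, d.2 + 2)]%SET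
       [set d.1; d'.1]%SET.

Definition squares : {set {set bedge}} :=
  [set s | [exists d, exists d', glued d d' && (s == square d d')]]%SET.

Definition boundary_edges (Q : {set {set bedge}}) : {set bedge} :=
  [set e in finset.cover Q | #|[set s in Q | e \in s]%SET| == 1%N]%SET.

End Matchings.

Definition symdiff (U : finType) (X Y : {set U}) : {set U} :=
  (X :|: Y) :\: (X :&: Y).


(* Fixed points of glue are the sides lying on the boundary; the two copies of
   the radius of a self-folded triangle are glued to each other. *)
Record gluing := Gluing {
  face :> finType;
  glue : face * 'I_3 -> face * 'I_3;
  glueK : involutive glue
}.

Section Polygon.
Variable K : gluing.

(* The next corner counterclockwise around the same vertex (meaningful when the
   side to be crossed is not on the boundary). *)
Definition rot (x : K * 'I_3) : K * 'I_3 :=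
  let y := glue (x.1, x.2 + 1) in (y.1, y.2 + 1).

(* A curve crosses n.+1 >= 1 sides (an arc not in the ideal triangulation
   crosses it at least once); it leaves the i-th triangle through the side
   d i, for i <= n, and then enters the next one through glue (d i).
   Values of d beyond n are irrelevant. *)
Variables (n : nat) (d : nat -> K * 'I_3).

(* The triangle passed through in position i <= n.+1. *)
Definition passed (i : nat) : K :=
  if i is j.+1 then (glue (d j)).1 else (d 0%N).1.

(* The corners at which the curve starts and ends: they are opposite to the
   first and to the last side crossed. *)
Definition start_corner : K * 'I_3 := d 0%N.
Definition end_corner : K * 'I_3 := glue (d n).

(* The other corners around the same puncture, counterclockwise. *)
Definition fan (x : K * 'I_3) : seq (K * 'I_3) := behead (fingraph.orbit rot x).

(* bp, bq: whether the arc is notched at its end and at its start. *)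
Variables (bp bq : bool).

Definition fan_size (b : bool) (x : K * 'I_3) : nat :=
  if b then size (fan x) else 0%N.

Definition polygon_tri : finType :=
  ('I_n.+2 + ('I_(fan_size bp end_corner) +
              'I_(fan_size bq start_corner)))%type.

Definition strip_glued (s s' : polygon_tri * 'I_3) : bool :=
  match s.1, s'.1 with
  | inl i, inl j =>
      [&& j == i.+1 :> nat, s.2 == (d i).2 & s'.2 == (glue (d i)).2]
  | _, _ => false
  end.

(* The copies of all the corners around the end (resp. start) puncture, in
   counterclockwise order. *)
Definition end_corners : seq (polygon_tri * 'I_3) :=
  (inl ord_max, end_corner.2) ::
  [seq (inr (inl j), (nth end_corner (fan end_corner) j).2)
     | j : 'I_(fan_size bp end_corner)].

Definition start_corners : seq (polygon_tri * 'I_3) :=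
  (inl ord0, start_corner.2) ::
  [seq (inr (inr j), (nth start_corner (fan start_corner) j).2)
     | j : 'I_(fan_size bq start_corner)].

Definition fan_glued (c : seq (polygon_tri * 'I_3))
    (s s' : polygon_tri * 'I_3) : bool :=
  has (fun y => let z := next c y in
                (s == (y.1, y.2 + 1)) && (s' == (z.1, z.2 + 2))) c.

Definition polygon : tri_complex :=
  @TriComplex polygon_tri (fun s s' =>
    [|| strip_glued s s', bp && fan_glued end_corners s s'
      | bq && fan_glued start_corners s s']).

End Polygon.


Local Open Scope classical_set_scope.
Local Open Scope card_scope.

Definition cplx (R : realType) := (R[i]%C)^o.

Definition closed_disc (R : realType) : set (cplx R) := [set z | `|z| <= 1].
Definition open_disc (R : realType) : set (cplx R) := [set z | `|z| < 1].
Definition circle (R : realType) : set (cplx R) := [set z | `|z| = 1].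
Definition half_plane (R : realType) : set (cplx R) := [set z | 0 <= complex.Im z].

(* Riemann surfaces with boundary.  Conformality of the changes of charts,
   expressed without inverse charts, says that g is complex differentiable
   with respect to f, relatively to the half-plane at boundary points. *)
Record riemann_surface (R : realType) := RiemannSurface {
  space :> topologicalType;
  charts : set (set space * (space -> cplx R));
  charts_cover : forall x : space, exists2 k, charts k & k.1 x;
  charts_open : forall k, charts k -> open k.1;
  charts_inj : forall k, charts k -> set_inj k.1 k.2;
  charts_continuous : forall k, charts k -> {within k.1, continuous k.2};
  charts_homeo : forall k, charts k -> forall V : set space,
    open V -> V `<=` k.1 ->
    exists2 W : set (cplx R), open W & k.2 @` V = W `&` @half_plane R;
  charts_conformal : forall k l, charts k -> charts l ->
    forall x, k.1 x -> l.1 x -> exists c : cplx R,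
    ((fun y => (l.2 y - l.2 x) / (k.2 y - k.2 x)) : space -> cplx R) y
      @[y --> x^'] --> c
}.

Section Surface.
Variables (R : realType) (S : riemann_surface R) (M : set S).
Notation C := (cplx R).
Implicit Types (A B X : set S) (phi : C -> S) (c : R -> S).

Definition bd : set S :=
  [set x | exists k, [/\ charts k, k.1 x & complex.Im (k.2 x) = 0]].

Definition is_disc : Prop :=
  exists f : C -> S, [/\ {within @closed_disc R, continuous f},
    set_inj (@closed_disc R) f & f @` @closed_disc R = [set: S]].

Definition sphere3 : set (R * R * R) :=
  [set x | x.1.1 ^+ 2 + x.1.2 ^+ 2 + x.2 ^+ 2 = 1].

Definition is_sphere : Prop :=
  exists f : R * R * R -> S, [/\ {within sphere3, continuous f},
    set_inj sphere3 f & f @` sphere3 = [set: S]].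

Definition excluded : Prop :=
  [\/ [/\ is_disc, M `&` bd #= `I_1 & M `\` bd #<= `I_1],
      is_disc /\ M `<=` bd /\ (M #= `I_2 \/ M #= `I_3)
    | is_sphere /\ M #<= `I_3].

Definition marked_surface : Prop :=
  [/\ compact [set: S], connected [set: S], hausdorff_space S &
      [/\ finite_set M, M !=set0,
          forall x, bd x -> exists2 m, M m & connected_component bd x m
        & ~ excluded]].


Definition simple_curve c : Prop :=
  [/\ {within `[0, 1], continuous c}, M (c 0), M (c 1),
      set_inj `]0, 1[ c & forall s, `]0, 1[ s -> ~ M (c s) /\ ~ bd (c s)].

Definition curve_image c : set S := c @` `[0, 1].

(* A is the boundary loop of the monogon parametrised by phi, and X is the set
   of marked points inside that monogon. *)
Definition monogon phi A X : Prop :=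
  [/\ {within @closed_disc R, continuous phi}, set_inj (@closed_disc R) phi,
      phi @` @circle R = A & M `&` phi @` @open_disc R = X].

(* The second side of the digon is a boundary segment.  The two vertices of the
   digon, the images of 1 and -1, may coincide. *)
Definition cuts_unpunctured_digon A : Prop := exists phi,
  [/\ {within @closed_disc R, continuous phi}, set_inj (@open_disc R) phi,
      forall z, @closed_disc R z -> M (phi z) <-> z = 1 \/ z = -1 &
      [/\ set_inj [set z | @circle R z /\ 0 < complex.Im z] phi,
          set_inj [set z | @circle R z /\ complex.Im z < 0] phi,
          phi @` [set z | @circle R z /\ 0 <= complex.Im z] = A
        & phi @` [set z | @circle R z /\ complex.Im z <= 0] `<=` bd]].

Definition is_arc A : Prop :=
  [/\ exists2 c, simple_curve c & curve_image c = A,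
      ~ (exists phi, monogon phi A set0)
    & ~ cuts_unpunctured_digon A].

(* Isotopy inside the class of simple curves joining marked points. *)
Definition isotopic A B : Prop := exists H : R * R -> S,
  [/\ {within `[0, 1] `*` `[0, 1], continuous H},
      forall s, `[0, 1] s -> simple_curve (fun t => H (s, t)),
      curve_image (fun t => H (0, t)) = A
    & curve_image (fun t => H (1, t)) = B].

Definition compatible A B : Prop := exists A' B',
  [/\ isotopic A A', isotopic B B' & A' `&` B' `<=` M].


(* A tagged arc is the underlying plain arc together with the set of its
   endpoints where it is notched; so the two ends of a loop automatically carry
   the same tag.  The endpoints of A are the points of A `&` M. *)
Definition tarc : Type := (set S * set S)%type.
Implicit Types (a b delta : tarc) (T : set tarc).

Definition tagged_arc a : Prop :=
  [/\ is_arc a.1, ~ (exists phi r, monogon phi a.1 [set r]),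
      a.2 `<=` a.1 `&` M, a.2 `&` bd = set0
    & bd = set0 -> M #= `I_1 -> a.2 = set0].

Definition tagged_compatible a b : Prop :=
  [/\ compatible a.1 b.1,
      isotopic a.1 b.1 -> exists2 x, (a.1 `&` M) x & (a.2 x <-> b.2 x)
    & ~ isotopic a.1 b.1 ->
      forall x, (a.1 `&` b.1 `&` M) x -> (a.2 x <-> b.2 x)].

(* Maximality makes T closed under isotopy. *)
Definition tagged_triangulation T : Prop :=
  [/\ T `<=` tagged_arc,
      forall a b, T a -> T b -> tagged_compatible a b
    & forall b, tagged_arc b -> (forall a, T a -> tagged_compatible a b) -> T b].

Definition one_notched_at a (r : S) : Prop :=
  a.2 = [set r] /\ exists2 o, o <> r & a.1 `&` M = [set o; r].

Definition condA1 T : Prop :=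
  (forall a, T a -> a.2 = set0 \/ exists r, one_notched_at a r) /\
  (forall r a b, T a -> T b -> one_notched_at a r -> one_notched_at b r ->
     isotopic a.1 b.1).

Definition condA2 T delta : Prop :=
  forall a r, T a -> one_notched_at a r -> ~ delta.2 r.

(* The arcs of the ideal triangulation T^0, up to isotopy. *)
Definition ideal_arcs T : set (set S) :=
  [set A | T (A, set0) \/
    exists a r phi, [/\ T a, one_notched_at a r, monogon phi A [set r], is_arc A
      & a.1 `<=` phi @` @closed_disc R]].


Definition vert (v : 'I_3) : C := tnth [tuple 0; 1; ('i)%C] v.

Definition side_point (v : 'I_3) (s : R) : C :=
  (1 - s%:C)%C * vert (v + 1) + (s%:C)%C * vert (v + 2).

Definition closed_triangle : set C :=
  [set z | [/\ 0 <= complex.Re z, 0 <= complex.Im z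
             & complex.Re z + complex.Im z <= 1]].
Definition open_triangle : set C :=
  [set z | [/\ 0 < complex.Re z, 0 < complex.Im z
             & complex.Re z + complex.Im z < 1]].

Variable K : gluing.

Definition side_image (phi : K -> C -> S) (d : K * 'I_3) : set S :=
  curve_image (fun s => phi d.1 (side_point d.2 s)).

(* phi t is a parametrisation of the triangle t of the ideal triangulation,
   preserving orientations since it is holomorphic in the interior; it exists
   by the Riemann mapping theorem and Caratheodory's theorem.  The boundary
   extension is injective on each open side, but the sides and the vertices of
   a triangle may be identified in S. *)
Definition realizes (T : set tarc) (phi : K -> C -> S) : Prop :=
  [/\ forall t, {within closed_triangle, continuous (phi t)},
      forall t z, open_triangle z -> forall k, charts k -> k.1 (phi t z) ->
        derivable (k.2 \o phi t) z 1,
      forall t z t' z', open_triangle z -> closed_triangle z' ->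
        phi t z = phi t' z' -> t = t' /\ z = z',
      forall x, exists t z, closed_triangle z /\ phi t z = x &
   [/\ forall t z, closed_triangle z -> M (phi t z) -> exists v, z = vert v,
      forall t v, M (phi t (vert v)),
      forall d, set_inj `]0, 1[ (fun s => phi d.1 (side_point d.2 s)),
      forall d d' s s', `]0, 1[ s -> `]0, 1[ s' ->
        phi d.1 (side_point d.2 s) = phi d'.1 (side_point d'.2 s') ->
        d' = d \/ d' = glue d &
   [/\ forall d, glue d = d -> side_image phi d `<=` bd,
      forall d, glue d <> d -> ideal_arcs T (side_image phi d),
      forall d, glue d <> d -> exists rho : R -> R,
        [/\ {within `[0, 1], continuous rho}, rho 0 = 0, rho 1 = 1,
            {in `[0, 1] &, {homo rho : s s' / s < s'}}
          & forall s, `[0, 1] s -> phi d.1 (side_point d.2 s) =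
             phi (glue d).1 (side_point (glue d).2 (1 - rho s))]
    & forall A, ideal_arcs T A ->
        exists2 d, glue d <> d & isotopic A (side_image phi d)]]].

(* The curve c crosses successively the sides d 0, ..., d n; between times t i
   and t i.+1 it runs inside the triangle passed d i, where sigma i is its lift
   to the model triangle.  It is in minimal position: it never leaves a triangle
   through the side by which it has just entered, and its first and last pieces
   join a corner to the opposite side. *)
Definition crosses (phi : K -> C -> S) c (n : nat) (d : nat -> K * 'I_3) : Prop :=
  exists (t : nat -> R) (sigma : nat -> R -> C),
  [/\ [/\ t 0%N = 0, t n.+2 = 1 & forall i, (i <= n.+1)%N -> t i < t i.+1],
      [/\ forall i, (i <= n)%N -> glue (d i) <> d i,
          forall i, (i <= n)%N -> (d i).1 = passed d i
        & forall i, (i < n)%N -> (glue (d i)).2 <> (d i.+1).2],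
      forall i, (i <= n.+1)%N ->
        [/\ {within `[t i, t i.+1], continuous (sigma i)},
            forall s, `]t i, t i.+1[ s -> open_triangle (sigma i s)
          & forall s, `[t i, t i.+1] s -> c s = phi (passed d i) (sigma i s)],
      forall i, (i <= n)%N ->
        (exists2 s, `]0, 1[ s & sigma i (t i.+1) = side_point (d i).2 s) /\
        (exists2 s, `]0, 1[ s &
           sigma i.+1 (t i.+1) = side_point (glue (d i)).2 s)
    & sigma 0%N 0 = vert (start_corner d).2 /\
      sigma n.+1 1 = vert (end_corner n d).2].

(* The triangulated polygon of delta, for a representative c of the underlying
   plain arc, going from q = c 0 to p = c 1. *)
Definition tagged_polygon delta c (n : nat) (d : nat -> K * 'I_3) : tri_complex :=
  polygon n d `[< delta.2 (c 1) >] `[< delta.2 (c 0) >].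

End Surface.

(* Main.v *)
Require Import Defs.
From mathcomp Require Import all_boot all_order all_algebra.
From mathcomp Require Import all_classical all_reals all_analysis.
From mathcomp Require Import zify.
Set Implicit Arguments.
Unset Strict Implicit.
Unset Printing Implicit Defensive.

(* The symmetric difference of two perfect matchings has even degree at every
   vertex, and each edge lies in at most two squares that are not degenerate, so
   it suffices to write every even subgraph as a sum modulo 2 of squares.  This
   is done by removing the triangles one at a time, first those around the start
   puncture, then those around the end puncture, then those of the strip from
   its end to its start.  If a triangle has a vertex that lies on none of the
   remaining triangles, an even subgraph of the remaining part contains none or
   both of the other two edges at the triangle, and in the second case adding
   the square of the opposite side removes them; the triangle closing up a fan
   has no such vertex but is adjacent to remaining triangles along two sides.
   The geometry of the arc only enters through the fact that it leaves each
   triangle by another side than that of entry.  In particular a puncture may be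
   surrounded by a single triangle, folded onto itself, although (A2) excludes
   this. *)

(** * Parity of symmetric differences *)

Section SymmetricDifference.
Variable U : finType.
Implicit Types X Y : {set U}.

Lemma in_symdiff X Y e : (e \in symdiff X Y) = (e \in X) (+) (e \in Y).
Proof. by rewrite !inE; do 2!case: (e \in _). Qed.

Lemma odd_card_symdiff X Y : odd #|symdiff X Y| = odd #|X| (+) odd #|Y|.
Proof.
rewrite /symdiff cardsD (finset.setIidPr _); last exact: fintype.subset_trans (finset.subsetIl _ _) (finset.subsetUl _ _).
rewrite oddB; last first.
  by apply: subset_leq_card; exact: fintype.subset_trans (finset.subsetIl _ _) (finset.subsetUl _ _).
by rewrite -oddD cardsUI oddD.
Qed.

Lemma sep_symdiff (p : pred U) X Y :
  [set e in symdiff X Y | p e]%SET =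
  symdiff [set e in X | p e]%SET [set e in Y | p e]%SET.
Proof.
apply/setP=> e; rewrite inE !in_symdiff !inE.
by case: (p e); rewrite ?andbT ?andbF.
Qed.

End SymmetricDifference.

(** * Sums modulo 2 of families of sets *)

Section OddSum.
Variable U : finType.
Implicit Types (X : {set U}) (Q : {set {set U}}).

Definition odd_sum Q : {set U} :=
  [set e | odd #|[set s in Q | e \in s]%SET|]%SET.

Lemma odd_sum0 : odd_sum finset.set0 = finset.set0.
Proof.
apply/setP=> e; rewrite !inE; apply/negbTE.
by rewrite (_ : [set _ | _]%SET = finset.set0) ?cards0 //; apply/setP=> s; rewrite !inE.
Qed.

Lemma odd_sum_symdiff Q Q' :
  odd_sum (symdiff Q Q') = symdiff (odd_sum Q) (odd_sum Q').
Proof.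
by apply/setP=> e; rewrite in_symdiff !inE (sep_symdiff (fun s : {set U} => e \in s)) odd_card_symdiff.
Qed.

Lemma odd_sum1 X : odd_sum [set X]%SET = X.
Proof.
apply/setP=> e; rewrite inE; case eX: (e \in X).
  rewrite (_ : [set _ | _]%SET = [set X]%SET) ?cards1 //; apply/setP=> s.
  by rewrite !inE; case: eqVneq => //= ->.
rewrite (_ : [set _ | _]%SET = finset.set0) ?cards0 //; apply/setP=> s.
by rewrite !inE; case: eqVneq => //= ->.
Qed.

End OddSum.

(** * Arithmetic of corners modulo 3 *)

Section Corners.
Local Open Scope ring_scope.
Import GRing.Theory.
Implicit Types i j : 'I_3.

Lemma I3_add12 i : i + 1 + 2 = i.
Proof. by rewrite -addrA (_ : 1 + 2 = 0) ?addr0 //; apply/val_inj. Qed.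

Lemma I3_add21 i : i + 2 + 1 = i.
Proof. by rewrite addrAC I3_add12. Qed.

Lemma I3_add11 i : i + 1 + 1 = i + 2.
Proof. by rewrite -addrA. Qed.

Lemma I3_add22 i : i + 2 + 2 = i + 1.
Proof. by rewrite -addrA (_ : 2 + 2 = 1) //; apply/val_inj. Qed.

Definition I3_addE := (I3_add11, I3_add12, I3_add21, I3_add22).

Lemma I3_neq1 i : (i + 1 == i) = false.
Proof. by rewrite -subr_eq0 addrAC subrr add0r. Qed.

Lemma I3_neq2 i : (i + 2 == i) = false.
Proof. by rewrite -subr_eq0 addrAC subrr add0r. Qed.

Lemma I3_neq12 i : (i + 1 == i + 2) = false.
Proof. by rewrite -I3_add11 eq_sym I3_neq1. Qed.

Lemma I3_neq21 i : (i + 2 == i + 1) = false.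
Proof. by rewrite eq_sym I3_neq12. Qed.

Definition I3_neqE := (I3_neq1, I3_neq2, I3_neq12, I3_neq21).

Lemma I3_cases i j : [\/ j = i, j = i + 1 | j = i + 2].
Proof.
rewrite -(subrK i j) addrC; move: (j - i) => k.
have [->|->|->] : [\/ k = 0, k = 1 | k = 2].
- by case: k => [[|[|[|//]]] ?]; [constructor 1|constructor 2|constructor 3]; apply/val_inj.
- by rewrite addr0; constructor 1.
- by constructor 2.
- by constructor 3.
Qed.

End Corners.

(** * Removing triangles from an even subgraph *)

Section Elimination.
Variable P : tri_complex.
Local Open Scope ring_scope.
Implicit Types (x y d : P * 'I_3) (t : P) (X Y : {set bedge P}).

Definition sym_glued d d' := glued d d' || glued d' d.

Lemma sym_gluedC d d' : sym_glued d d' = sym_glued d' d.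
Proof. exact: orbC. Qed.

Lemma identified_sym : symmetric (@identified P).
Proof.
suff H x y : identified x y -> identified y x by move=> x y; apply/idP/idP; apply: H.
case/existsP=> d /existsP[d' /andP[g h]].
apply/existsP; exists d'; apply/existsP; exists d; rewrite orbC g /=.
by case/orP: h => /andP[-> ->] //; rewrite ?orbT.
Qed.

Lemma eq_vertexP x y : reflect (vertex x = vertex y) (connect (@identified P) x y).
Proof.
have csym := sym_connect_sym identified_sym.
apply: (iffP idP) => [xy|/setP/(_ y)]; last by rewrite !inE connect0.
by apply/setP=> z; rewrite !inE; apply: (same_connect csym).
Qed.

Lemma mem_vertex x : x \in vertex x.
Proof. by rewrite inE connect0. Qed.

Lemma vertexP v x : v \in vertices P -> x \in v -> v = vertex x.
Proof. by case/imsetP=> y _ ->; rewrite inE => /eq_vertexP. Qed.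

Lemma sym_glued_vertex1 d d' : sym_glued d d' ->
  vertex (d.1, d.2 + 1) = vertex (d'.1, d'.2 + 2).
Proof.
move=> g; apply/eq_vertexP/connect1/existsP; exists d.
by apply/existsP; exists d'; rewrite -/(sym_glued d d') g !eqxx.
Qed.

Lemma sym_glued_vertex2 d d' : sym_glued d d' ->
  vertex (d.1, d.2 + 2) = vertex (d'.1, d'.2 + 1).
Proof. by move=> g; rewrite (@sym_glued_vertex1 d' d) // sym_gluedC. Qed.

Lemma squareC d d' : sym_glued d d' -> square d d' = square d' d.
Proof.
move=> g; rewrite /square (sym_glued_vertex1 g) (sym_glued_vertex2 g).
by congr (finset.setX _ _); exact: finset.setUC.
Qed.

(* Squares whose two black corners coincide, which occur when a side of a
   triangle is a loop, are useless: their four sides cancel in pairs. *)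
Definition good_squares : {set {set bedge P}} :=
  [set s | [exists d, exists d',
    [&& sym_glued d d', vertex (d.1, d.2 + 1) != vertex (d.1, d.2 + 2)
      & s == square d d']]]%SET.

Lemma good_squares_sub : good_squares \subset squares P.
Proof.
apply/fintype.subsetP=> s; rewrite !inE => /existsP[d /existsP[d' /and3P[g _ /eqP->]]].
case/orP: (g) => g'; apply/existsP; [exists d|exists d']; apply/existsP; [exists d'|exists d].
  by rewrite g' /=.
by rewrite g' squareC /=.
Qed.

(** Cycles modulo 2 of the incidence graph between triangles and their vertices. *)
Definition even_subgraph X : Prop :=
  [/\ forall e, e \in X -> exists i, e.1 = vertex (e.2, i),
      forall v, ~~ odd #|[set e in X | e.1 == v]%SET|
    & forall t, ~~ odd #|[set e in X | e.2 == t]%SET|].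

Lemma even_subgraph_symdiff X Y :
  even_subgraph X -> even_subgraph Y -> even_subgraph (symdiff X Y).
Proof.
move=> [iX bX wX] [iY bY wY]; split=> [e|v|t].
- by rewrite in_symdiff; case eX: (e \in X) => /= h; [exact: iX|exact: iY].
- by rewrite sep_symdiff odd_card_symdiff (negbTE (bX v)) (negbTE (bY v)).
- by rewrite sep_symdiff odd_card_symdiff (negbTE (wX t)) (negbTE (wY t)).
Qed.

(** A square is a product of two sets, which both have size 2 by the two inequalities; so every
    degree is 0 or 2. *)
Lemma even_subgraph_square d d' : sym_glued d d' -> d.1 != d'.1 ->
  vertex (d.1, d.2 + 1) != vertex (d.1, d.2 + 2) -> even_subgraph (square d d').
Proof.
move=> g nt nv; split=> [[v t]|v|t].
- rewrite !inE /= => /andP[/orP[]/eqP-> /orP[]/eqP->].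
  + by exists (d.2 + 1).
  + by exists (d'.2 + 2); apply: sym_glued_vertex1.
  + by exists (d.2 + 2).
  + by exists (d'.2 + 1); apply: sym_glued_vertex2.
- set A := [set vertex (d.1, d.2 + 1); vertex (d.1, d.2 + 2)]%SET.
  rewrite (_ : [set _ | _]%SET = finset.setX (A :&: [set v]%SET) [set d.1; d'.1]%SET).
    by rewrite cardsX cards2 nt oddM andbF.
  by apply/setP=> -[w t]; rewrite !inE /= andbAC.
- set B := [set d.1; d'.1]%SET.
  set A := [set vertex (d.1, d.2 + 1); vertex (d.1, d.2 + 2)]%SET.
  rewrite (_ : [set _ | _]%SET = finset.setX A (B :&: [set t]%SET)).
    by rewrite cardsX cards2 nv oddM.
  by apply/setP=> -[w t']; rewrite !inE /= andbA.
Qed.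

(** Both matchings have degree 1 at triangles and black vertices, and degree 0 at any other set of
    corners. *)
Lemma even_subgraph_matchings (E F : {set bedge P}) :
  perfect_matching E -> perfect_matching F -> even_subgraph (symdiff E F).
Proof.
move=> [sE bE wE] [sF bF wF].
have inc (G : {set bedge P}) : G \subset graph_edges P ->
    forall e, e \in G -> e.1 \in black_vertices P /\ exists i, e.1 = vertex (e.2, i).
  move=> /fintype.subsetP sG [v t] /sG; rewrite inE => /andP[bv /existsP[[t' i] /andP[/= xv /eqP <-]]].
  split=> //; exists i; apply: vertexP xv.
  by move: bv; rewrite inE => /andP[].
split=> [e|v|t].
- by rewrite in_symdiff; case eE: (e \in E) => /= h; [case: (inc E sE _ eE)|case: (inc F sF _ h)].
- rewrite sep_symdiff odd_card_symdiff.
  have [bv|nbv] := boolP (v \in black_vertices P); first by rewrite bE ?bF.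
  suff H (G : {set bedge P}) : G \subset graph_edges P -> [set e in G | e.1 == v]%SET = finset.set0.
    by rewrite (H E) ?(H F) // cards0.
  move=> sG; apply/setP=> e; rewrite !inE; apply/negbTE/negP => /andP[eG /eqP ev].
  by have [] := inc G sG _ eG; rewrite ev (negbTE nbv).
- by rewrite sep_symdiff odd_card_symdiff wE wF.
Qed.

Variable rank : P -> nat.
Hypothesis rank_inj : injective rank.

Definition supported_below k X := forall e, e \in X -> (rank e.2 < k)%N.

Definition free_corner x := forall y, vertex x = vertex y -> (rank x.1 <= rank y.1)%N.

(** Otherwise this would be the only edge of [X] at its black vertex, against evenness. *)
Lemma free_cornerN X x : even_subgraph X -> supported_below (rank x.1).+1 X ->
  free_corner x -> (vertex x, x.1) \notin X.
Proof.
move=> [iX bX _] sX fx; apply/negP=> eX.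
have := bX (vertex x).
rewrite (_ : [set _ | _]%SET = [set (vertex x, x.1)]%SET) ?cards1 //.
apply/setP=> -[v t]; rewrite !inE xpair_eqE /=; apply/andP/andP => [[vtX /eqP ev]|[/eqP-> /eqP->]]; last first.
  by split.
split; first by rewrite ev.
apply/eqP/rank_inj/eqP; rewrite eqn_leq -ltnS (sX _ vtX) /=.
by have [i /= vi] := iX _ vtX; apply: (fx (t, i)); rewrite -ev.
Qed.

Definition reducible X (k : nat) := exists Q : {set {set bedge P}}, Q \subset good_squares /\
  let Y := symdiff X (odd_sum Q) in even_subgraph Y /\ supported_below k Y.

Lemma reducible_toggle X k s : s \in good_squares ->
  reducible (symdiff X s) k -> reducible X k.
Proof.
move=> sg [Q [Qg H]]; exists (symdiff Q [set s]%SET); split.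
  apply/fintype.subsetP=> s'; rewrite in_symdiff inE.
  by case: eqVneq => [->|_] //; rewrite addbF; move/fintype.subsetP: Qg; apply.
rewrite odd_sum_symdiff odd_sum1 (_ : symdiff X _ = symdiff (symdiff X s) (odd_sum Q)) //.
by apply/setP=> e; rewrite !in_symdiff addbAC addbA.
Qed.

Lemma supported_below_square d d' k : (rank d'.1 < rank d.1)%N -> (rank d.1 < k)%N ->
  supported_below k (square d d').
Proof.
move=> ld dk [v t]; rewrite !inE /= => /andP[_ /orP[]/eqP->] //.
exact: ltn_trans dk.
Qed.

Lemma supported_below_symdiff k X Y : supported_below k X -> supported_below k Y ->
  supported_below k (symdiff X Y).
Proof. by move=> sX sY e; rewrite in_symdiff; case eX: (e \in X) => /= h; [exact: sX|exact: sY]. Qed.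

Lemma good_square d d' : sym_glued d d' ->
  vertex (d.1, d.2 + 1) != vertex (d.1, d.2 + 2) -> square d d' \in good_squares.
Proof.
by move=> g nv; rewrite inE; apply/existsP; exists d; apply/existsP; exists d'; rewrite g nv /=.
Qed.

Lemma reducible_isolated X t : even_subgraph X -> supported_below (rank t).+1 X ->
  (forall v, (v, t) \notin X) -> reducible X (rank t).
Proof.
move=> eX sX nt; exists finset.set0; split; first exact: finset.sub0set.
rewrite odd_sum0 (_ : symdiff X _ = X); last by apply/setP=> e; rewrite in_symdiff inE addbF.
split=> // -[v t'] vX; rewrite ltn_neqAle -ltnS sX // andbT.
by apply: contraTneq vX => /rank_inj /= ->.
Qed.

(** Edges at [t] can only go to the ends of side [i], and evenness at [t] leaves none or both. In
    the second case the square across this side cancels both and otherwise only touches [d'.1], of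
    smaller rank. *)
Lemma reducible_side X t i d' : even_subgraph X -> supported_below (rank t).+1 X ->
  sym_glued (t, i) d' -> (rank d'.1 < rank t)%N ->
  [\/ (vertex (t, i), t) \notin X, vertex (t, i) = vertex (t, i + 1)
    | vertex (t, i) = vertex (t, i + 2)] ->
  reducible X (rank t).
Proof.
move=> eX sX g lt h.
set a := vertex (t, i + 1); set b := vertex (t, i + 2).
have only v : (v, t) \in X -> v = a \/ v = b.
  move=> vX; case: eX => /(_ _ vX)[j /= vj] _ _.
  case: (I3_cases i j) vj => -> vi; [|by left|by right].
  by case: h => h; [rewrite vi (negbTE h) in vX|left; rewrite vi|right; rewrite vi].
have sub0 : (a, t) \notin X -> (b, t) \notin X -> reducible X (rank t).
  move=> na nb; apply: reducible_isolated => // v; apply/negP => vX.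
  by case: (only _ vX) => vab; move: vX; rewrite vab ?(negbTE na) ?(negbTE nb).
have wt : [set e in X | e.2 == t]%SET = [set e in X :&: [set (a, t); (b, t)]%SET]%SET.
  apply/setP=> -[v t']; rewrite !inE !xpair_eqE; case vX: (_ \in X) => //=.
  case: eqVneq => [tt|_]; rewrite ?andbF ?andbT // tt in vX *.
  by case: (only _ vX) => ->; rewrite eqxx ?orbT.
have [_ _ /(_ t)] := eX; rewrite wt {wt} => par.
(* For a loop the two possible edges coincide, and a single edge at [t] would violate evenness. *)
have [ab|nab] := eqVneq a b.
  have na : (a, t) \notin X.
    apply/negP=> aX; move: par; rewrite (_ : [set _ in _]%SET = [set (a,t)]%SET) ?cards1 //.
    apply/setP=> e; rewrite !inE -ab orbb andbC; case: eqVneq => //= -> //.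
  by apply: sub0 => //; rewrite -ab.
have abX : ((a, t) \in X) = ((b, t) \in X).
  case aX: (_ \in X); case bX: (_ \in X) => //; exfalso; move: par.
    rewrite (_ : [set _ in _]%SET = [set (a,t)]%SET) ?cards1 //.
    apply/setP=> e; rewrite !inE andbC; case: eqVneq => //= [-> //|_].
    by case: eqVneq => //= ->.
  rewrite (_ : [set _ in _]%SET = [set (b,t)]%SET) ?cards1 //.
  apply/setP=> e; rewrite !inE andbC orbC; case: eqVneq => //= [-> //|_].
  by case: eqVneq => //= ->.
case aX: ((a, t) \in X); last by apply: sub0 => //; rewrite -?abX ?aX.
have nt : t != d'.1 by apply: contraTneq lt => <-; rewrite ltnn.
exists [set square (t, i) d']%SET; split; first by rewrite finset.sub1set good_square.
rewrite odd_sum1.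
have eY : even_subgraph (square (t, i) d') by apply: even_subgraph_square.
split; first exact: even_subgraph_symdiff.
have sY : supported_below (rank t).+1 (symdiff X (square (t, i) d')).
  by apply: supported_below_symdiff => //; apply: supported_below_square.
move=> [v t'] vY; rewrite ltn_neqAle -ltnS sY // andbT; apply/eqP=> /rank_inj /= tt.
move: vY; rewrite {}tt in_symdiff !inE eqxx !andbT /= -/a -/b.
have [->|na] := eqVneq v a; first by rewrite aX.
have [->|nb] := eqVneq v b; first by rewrite -abX aX.
by rewrite addbF => /only[] vab; rewrite vab eqxx in na nb.
Qed.

(** The alternatives are meant for the first triangle of the strip, for a triangle attached along
    one side, and for a triangle closing up a fan. In the second, the opposite vertex may coincide
    with an end of that side. *)
Definition removable t : Prop :=
  [\/ forall i, free_corner (t, i),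
      exists i d', [/\ sym_glued (t, i) d', (rank d'.1 < rank t)%N &
        [\/ free_corner (t, i), vertex (t, i) = vertex (t, i + 1)
          | vertex (t, i) = vertex (t, i + 2)]]
    | exists i d1 d2, [/\ sym_glued (t, i) d1, sym_glued (t, i + 1) d2,
        (rank d1.1 < rank t)%N & (rank d2.1 < rank t)%N]].

Lemma reducible_removable X t : removable t -> even_subgraph X ->
  supported_below (rank t).+1 X -> reducible X (rank t).
Proof.
move=> rt eX sX; case: rt => [ft|[i [d' [g lt h]]]|[i [d1 [d2 [g1 g2 l1 l2]]]]].
- apply: reducible_isolated => // v; apply/negP => vX.
  have [/(_ _ vX)[i /= vi] _ _] := eX; rewrite {}vi in vX.
  by move: (@free_cornerN X (t, i) eX sX (ft i)); rewrite vX.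
- apply: reducible_side g lt _ => //; case: h => h.
  + by constructor 1; apply: (@free_cornerN X (t, i)) h.
  + by constructor 2.
  + by constructor 3.
have [tX|tX] := boolP ((vertex (t, i), t) \in X); last first.
  by apply: reducible_side g1 l1 _ => //; constructor 1.
have [e|ne] := eqVneq (vertex (t, i)) (vertex (t, i + 2)).
  by apply: reducible_side g1 l1 _ => //; constructor 3.
(* Side [i + 1] runs from corner [i + 2] to corner [i], so adding its square removes the edge at
   corner [i]. *)
have gd : vertex ((t, i + 1).1, (t, i + 1).2 + 1) != vertex ((t, i + 1).1, (t, i + 1).2 + 2).
  by rewrite /= !I3_addE eq_sym.
apply: (@reducible_toggle _ _ (square (t, i + 1) d2)); first exact: good_square.
apply: reducible_side g1 l1 _.
- apply: even_subgraph_symdiff => //; apply: even_subgraph_square => //=.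
  by apply: contraTneq l2 => <-; rewrite ltnn.
- by apply: supported_below_symdiff => //; apply: supported_below_square.
- by constructor 1; rewrite in_symdiff tX !inE /= !I3_addE !eqxx orbT.
Qed.

(** Induction on a strict bound for the ranks: the triangle of highest rank is cleared, and the
    families found at successive stages are added modulo 2. *)
Lemma even_subgraph_span X : (forall t, removable t) -> even_subgraph X ->
  exists2 Q : {set {set bedge P}}, Q \subset good_squares & X = odd_sum Q.
Proof.
move=> rem; suff H k : forall X, even_subgraph X -> supported_below k X ->
    exists2 Q : {set {set bedge P}}, Q \subset good_squares & X = odd_sum Q.
  move=> eX; apply: (H (\max_(t : P) rank t).+1 X eX) => e _.
  by rewrite ltnS; exact: leq_bigmax.
elim: k => [|k IH] {}X eX sX.
  exists finset.set0; rewrite ?finset.sub0set // odd_sum0; apply/setP=> e; rewrite inE.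
  by apply/negbTE/negP=> /sX.
have [/existsP[t /eqP rt]|/existsPn nt] := boolP [exists t, rank t == k]; last first.
  apply: IH => // e eX'; rewrite ltn_neqAle -ltnS sX // andbT; exact: nt.
rewrite -{}rt in sX IH.
have [Q [Qg [eY sY]]] := reducible_removable (rem t) eX sX.
have [Q' Qg' Y'] := IH _ eY sY.
exists (symdiff Q Q').
  apply/fintype.subsetP=> s; rewrite in_symdiff.
  by case sQ: (s \in Q) => /=; [move=> _; move: sQ|]; apply/fintype.subsetP.
by rewrite odd_sum_symdiff -Y'; apply/setP=> e; rewrite !in_symdiff addbCA addbb addbF.
Qed.

End Elimination.

(** * Boundary edges as sums modulo 2 *)

Section BoundaryEdges.
Variable P : tri_complex.
Local Open Scope ring_scope.
Hypothesis glued_fun : forall d d1 d2 : P * 'I_3,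
  sym_glued d d1 -> sym_glued d d2 -> d1 = d2.

(* The squares through the edge at a corner correspond to the two adjacent
   sides; the third side may only contribute if the triangle has another corner
   at the same vertex, but then one of the other two sides is a loop. *)
Lemma card_good_squares (Q : {set {set bedge P}}) (e : bedge P) :
  Q \subset good_squares P -> (#|[set s in Q | e \in s]%SET| <= 2)%N.
Proof.
case: e => v t Qg.
pose I := [set i : 'I_3 | (vertex (t, i + 1) != vertex (t, i + 2)) &&
  (v \in [set vertex (t, i + 1); vertex (t, i + 2)])]%SET.
pose f (i : 'I_3) : {set bedge P} :=
  if [pick d' | sym_glued (t, i) d'] is Some d' then square (t, i) d' else finset.set0.
have fI s : s \in [set s in Q | (v, t) \in s]%SET -> s \in [set f i | i in I]%SET.
  rewrite inE => /andP[/(fintype.subsetP Qg)]; rewrite inE.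
  case/existsP=> d /existsP[d' /and3P[g nv /eqP->]] vts.
  have ff x y : sym_glued x y -> x.1 = t -> vertex (x.1, x.2 + 1) != vertex (x.1, x.2 + 2) ->
      (v, t) \in square x y -> square x y \in [set f i | i in I]%SET.
    case: x => a i gx /= ta; rewrite {}ta in gx * => nx; rewrite finset.in_setX => /andP[/= vx _].
    apply/imsetP; exists i; first by rewrite inE nx.
    rewrite /f; case: pickP => [y' gy|/(_ y)]; last by rewrite gx.
    by rewrite (glued_fun gx gy).
  have : t \in [set d.1; d'.1]%SET by move: vts; rewrite finset.in_setX => /andP[].
  rewrite !inE => /orP[/eqP td|/eqP td]; first exact: ff.
  have g' : sym_glued d' d by rewrite sym_gluedC.
  rewrite squareC // in vts *; apply: ff => //.
  by rewrite (sym_glued_vertex1 g') (sym_glued_vertex2 g') eq_sym.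
have I2 : (#|I| <= 2)%N.
  have [i iI] : exists i, i \notin I.
    apply/existsP; rewrite -negb_forall; apply/negP=> /forallP h.
    move: (h 0) (h (0 + 1)) (h (0 + 2)); rewrite !inE !I3_addE.
    move/andP=> [n0 /orP[]/eqP->] /andP[n1 h1] /andP[n2 h2].
      by move: h1; rewrite (negbTE n0) eq_sym (negbTE n2).
    by move: h2; rewrite (negbTE n1) eq_sym (negbTE n0).
  have : I \proper finset.setT by rewrite finset.properT; apply: contraNneq iI => ->; rewrite inE.
  by move/proper_card; rewrite cardsT card_ord.
apply: leq_trans I2; apply: leq_trans (leq_imset_card f I).
by apply: subset_leq_card; apply/fintype.subsetP.
Qed.

(** An edge lies in at most two good squares, so an odd number of them means exactly one. *)
Lemma boundary_edgesE (Q : {set {set bedge P}}) :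
  Q \subset good_squares P -> boundary_edges Q = odd_sum Q.
Proof.
move=> Qg; apply/setP=> e; rewrite !inE.
have := card_good_squares e Qg; set q := #|_|.
have [->|q0] := posnP q; first by rewrite andbF.
suff -> : e \in finset.cover Q by case: q q0 => [|[|[|]]].
have /card_gt0P[s] := q0; rewrite inE => /andP[sQ es].
by apply/finset.bigcupP; exists s.
Qed.

End BoundaryEdges.

(** * Fans around a puncture *)

Section PolygonFan.
Variables (K : gluing) (n : nat) (d : nat -> K * 'I_3) (bp bq : bool).
Local Notation P := (polygon n d bp bq).
Local Open Scope ring_scope.
Implicit Types (s t x : P * 'I_3) (y : P * 'I_3) (c : seq (P * 'I_3)).

Definition cyc_succ c k : nat := if (k.+1 < size c)%N then k.+1 else 0%N.

Lemma fan_gluedP y0 c s t : uniq [seq y.1 | y <- c] ->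
  reflect (exists k, [/\ (k < size c)%N,
      s = ((nth y0 c k).1, (nth y0 c k).2 + 1)
    & t = ((nth y0 c (cyc_succ c k)).1, (nth y0 c (cyc_succ c k)).2 + 2)])
  (fan_glued c s t).
Proof.
move=> /map_uniq uc.
have nx k : (k < size c)%N -> next c (nth y0 c k) = nth y0 c (cyc_succ c k).
  move=> kc; rewrite next_nth mem_nth // index_uniq // /cyc_succ.
  case: c uc kc => [|y c] //= uc kc; rewrite ltnS.
  (* At the last position the default value of [nth] is the head of the cycle, which is the cyclic
     successor. *)
  case: ltnP => kc'; first exact: set_nth_default.
  by rewrite nth_default.
apply: (iffP hasP) => [[y yc /andP[/eqP-> /eqP->]]|[k [kc -> ->]]].
  by exists (index y c); rewrite index_mem yc -nx ?index_mem // nth_index.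
by exists (nth y0 c k); [exact: mem_nth|rewrite nx //= !eqxx].
Qed.

Definition sym_fan_glued c s t := fan_glued c s t || fan_glued c t s.

(** Fans are glued along the two sides meeting at the puncture; this separates their gluings from
    those of the strip. *)
Lemma sym_fan_glued_mem c s t : uniq [seq y.1 | y <- c] -> sym_fan_glued c s t ->
  exists2 y, y \in c & s.1 = y.1 /\ s.2 != y.2.
Proof.
case: c => [|y0 c'] // uc; set c := _ :: _ in uc *.
have cs k : (k < size c)%N -> (cyc_succ c k < size c)%N.
  by rewrite /cyc_succ; case: ifP.
case/orP=> /(fan_gluedP y0 _ _ uc)[k [kc h h']]; [rewrite h|rewrite h'].
  by exists (nth y0 c k); rewrite ?mem_nth //= I3_neqE.
by exists (nth y0 c (cyc_succ c k)); rewrite ?mem_nth ?cs //= I3_neqE.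
Qed.

(** The triangles are distinct, so a side determines its position in the cycle and whether it is
    clockwise or counterclockwise from the corner at the puncture. *)
Lemma sym_fan_glued_fun c s t1 t2 : uniq [seq y.1 | y <- c] ->
  sym_fan_glued c s t1 -> sym_fan_glued c s t2 -> t1 = t2.
Proof.
case: c => [|y0 c'] // uc; set c := _ :: _ in uc *.
have cs k : (k < size c)%N -> (cyc_succ c k < size c)%N.
  by rewrite /cyc_succ; case: ifP.
have inj k l : (k < size c)%N -> (l < size c)%N -> (nth y0 c k).1 = (nth y0 c l).1 -> k = l.
  move=> kc lc; rewrite -!(nth_map y0 y0.1 fst) // => /eqP.
  by rewrite nth_uniq ?size_map // => /eqP.
have csI k l : (k < size c)%N -> (l < size c)%N -> cyc_succ c k = cyc_succ c l -> k = l.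
  by rewrite /cyc_succ; do 2!case: ifP; lia.
have off k l : (k < size c)%N -> (l < size c)%N ->
    ((nth y0 c k).1, (nth y0 c k).2 + 1) <> ((nth y0 c l).1, (nth y0 c l).2 + 2).
  move=> kc lc e; have /= e1 := congr1 fst e; have /= /eqP := congr1 snd e.
  by rewrite (inj _ _ kc lc e1) I3_neqE.
case/orP=> /(fan_gluedP y0 _ _ uc)[k [kc h h']];
  case/orP=> /(fan_gluedP y0 _ _ uc)[l [lc e e']].
- by move: h; rewrite h' e' e => /(congr1 fst)/(inj _ _ lc kc)->.
- by case: (off k (cyc_succ c l)); rewrite ?cs // -h -e'.
- by case: (off l (cyc_succ c k)); rewrite ?cs // -e -h'.
- by move: h'; rewrite h e e' => /(congr1 fst)/(inj _ _ (cs _ lc) (cs _ kc))/(csI _ _ lc kc)->.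
Qed.

(* Labels at the corners of the [k]-th triangle glued on around a puncture, out
   of [m], when [y] is the corner of that triangle at the puncture and [x] the
   corner at the puncture of the triangle that was already there, with labels
   [L]: the outer vertices that are not in the latter get consecutive labels
   starting from [b]. *)
Definition fan_label (L : 'I_3 -> nat) (b m : nat) (x y : 'I_3) (k : nat) (v : 'I_3) : nat :=
  if v == y then L x
  else if v == y + 1 then (if k is l.+1 then (b + l)%N else L (x + 2))
  else (if k.+1 == m then L (x + 1) else (b + k)%N).

(** * Vertex labels around a puncture *)

Section FanLabels.
Variables (x : P * 'I_3) (c' : seq (P * 'I_3)) (lab : P * 'I_3 -> nat) (b : nat).
Let c := x :: c'.
Hypothesis uc : uniq [seq y.1 | y <- c].
Hypothesis lab_fan : forall k v, (k < size c')%N ->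
  lab ((nth x c' k).1, v) =
  fan_label (fun w => lab (x.1, w)) b (size c') x.2 (nth x c' k).2 k v.
Hypothesis lab_loop : size c' = 0%N -> lab (x.1, x.2 + 1) = lab (x.1, x.2 + 2).

Lemma fan_glued_label s t : fan_glued c s t ->
  lab (s.1, s.2 + 1) = lab (t.1, t.2 + 2) /\ lab (s.1, s.2 + 2) = lab (t.1, t.2 + 1).
Proof.
case/(fan_gluedP x _ _ uc)=> k [kc -> ->]; rewrite /= !I3_addE /cyc_succ /=.
move: kc; rewrite /= ltnS leq_eqVlt => /orP[/eqP->|kc].
  (* The gluing that closes up the cycle. With an empty fan it folds the triangle of [x] onto
     itself, and [lab_loop] gives the equality. *)
  rewrite ltnn /= -/c -last_nth /c.
  case E: (size c') => [|m].
    by rewrite (size0nil E) /= -lab_loop // (size0nil E).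
  rewrite (last_nth x) E /= !lab_fan ?E // /fan_label !eqxx.
  by rewrite I3_neq2 I3_neq21.
rewrite ltnS kc /=; case: k kc => [|k] kc /=.
  by rewrite !lab_fan // /fan_label !eqxx I3_neq1.
rewrite !lab_fan ?(ltnW kc) // /fan_label !eqxx I3_neq1 I3_neq2 I3_neq21.
by rewrite ltn_eqF.
Qed.

Variable rank : P -> nat.
Hypothesis rank_fan : forall k, (k < size c')%N -> rank (nth x c' k).1 = (b + k)%N.
Hypothesis rank_base : (rank x.1 < b)%N.
Hypothesis lab_le : forall y, (lab y <= rank y.1)%N.
Hypothesis lab_vertex : forall y z, vertex y = vertex z -> lab y = lab z.
Hypothesis glued_c : forall s t, fan_glued c s t -> sym_glued s t.

(** Labels are constant on vertices and at most the rank, so a corner whose label equals the rank of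
    its triangle is free. Every triangle but the last has such a corner, opposite to the side shared
    with its predecessor; the last one is glued along two sides to triangles of smaller rank. *)
Lemma fan_removable k : (k < size c')%N -> removable rank (nth x c' k).1.
Proof.
move=> kc; set y := nth x c' k.
have g1 : sym_glued (y.1, y.2 + 2) ((nth x c k).1, (nth x c k).2 + 1).
  rewrite sym_gluedC; apply/glued_c/(fan_gluedP x _ _ uc).
  by exists k; rewrite /cyc_succ /= !ltnS kc ltnW.
have r1 : (rank (nth x c k).1 < rank y.1)%N.
  rewrite rank_fan //; case: k {y g1} kc => [|k] kc /=; first by rewrite addn0.
  by rewrite rank_fan ?(ltnW kc) // ltn_add2l.
have [km|km] := eqVneq k.+1 (size c'); last first.
  constructor 2; exists (y.2 + 2), ((nth x c k).1, (nth x c k).2 + 1); split=> //.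
  constructor 1 => z vz /=; rewrite rank_fan //.
  apply: leq_trans (lab_le z); rewrite -(lab_vertex vz) lab_fan //.
  by rewrite /fan_label I3_neq2 I3_neq21 (negbTE km).
constructor 3; exists (y.2 + 1), (x.1, x.2 + 2), ((nth x c k).1, (nth x c k).2 + 1).
split=> //=; last by rewrite rank_fan // (leq_trans rank_base) ?leq_addr.
  apply/glued_c/(fan_gluedP x _ _ uc); exists k.+1.
  by rewrite /cyc_succ /= !ltnS -km ltnn.
by rewrite I3_addE.
Qed.

End FanLabels.
End PolygonFan.

Lemma fan_size_gt (K : gluing) b (x : K * 'I_3) k : (k < fan_size b x)%N -> b.
Proof. by case: b. Qed.

(** * Gluings of the polygon *)

Section PolygonSquares.
Variables (K : gluing) (n : nat) (d : nat -> K * 'I_3) (bp bq : bool).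
Local Open Scope ring_scope.
Hypothesis turn : forall i, (i < n)%N -> (Defs.glue (d i)).2 <> (d i.+1).2.
Local Notation P := (polygon n d bp bq).
Local Notation mp := (fan_size bp (end_corner n d)).
Local Notation mq := (fan_size bq (start_corner d)).
Local Notation ecs := (end_corners n d bp bq : seq (P * 'I_3)).
Local Notation scs := (start_corners n d bp bq : seq (P * 'I_3)).
Implicit Types (s t y : P * 'I_3).

Lemma uniq_end_corners : uniq [seq y.1 | y <- ecs].
Proof.
rewrite /= -map_comp map_inj_uniq ?enum_uniq ?andbT; last by move=> j k [].
by apply/mapP=> -[].
Qed.

Lemma uniq_start_corners : uniq [seq y.1 | y <- scs].
Proof.
rewrite /= -map_comp map_inj_uniq ?enum_uniq ?andbT; last by move=> j k [].
by apply/mapP=> -[].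
Qed.

Lemma sym_gluedP s t : sym_glued s t ->
  [\/ strip_glued s t || strip_glued t s, bp && sym_fan_glued ecs s t
    | bq && sym_fan_glued scs s t].
Proof.
rewrite /sym_glued /sym_fan_glued /=.
case/orP=> /or3P[h|/andP[hb h]|/andP[hb h]].
- by constructor 1; rewrite h.
- by constructor 2; apply/andP; rewrite h.
- by constructor 3; apply/andP; rewrite h.
- by constructor 1; rewrite h orbT.
- by constructor 2; apply/andP; rewrite h orbT.
- by constructor 3; apply/andP; rewrite h orbT.
Qed.

Lemma strip_gluedP s t : strip_glued s t ->
  exists i j : 'I_n.+2, [/\ j = i.+1 :> nat, s = (inl i, (d i).2)
    & t = (inl j, (Defs.glue (d i)).2)].
Proof.
case: s t => -[i|?] a [[j|?] b] //= /and3P[/eqP ij /eqP/= -> /eqP/= ->].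
by exists i, j.
Qed.

(** The end fan meets the last triangle of the strip along the two sides at the puncture, whereas
    the strip meets it along the opposite side. *)
Lemma strip_not_end s t u : strip_glued s t || strip_glued t s ->
  sym_fan_glued ecs s u -> False.
Proof.
move=> st /(sym_fan_glued_mem uniq_end_corners)[y]; rewrite inE => /orP[/eqP->|/mapP[j _ ->]] [/= e1 e2].
  case/orP: st => /strip_gluedP[i [j [ij es et]]].
    by move: e1 ij; rewrite es /= => -[->] /=; have := ltn_ord j; lia.
  move: e1 e2; rewrite et /= => -[e1]; rewrite /end_corner.
  by have -> : (i = n :> nat); [move: ij; rewrite e1 /=; lia|rewrite eqxx].
by case/orP: st e1 => /strip_gluedP[i [k [_ es et]]]; rewrite ?es ?et.
Qed.

Lemma strip_not_start s t u : strip_glued s t || strip_glued t s ->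
  sym_fan_glued scs s u -> False.
Proof.
move=> st /(sym_fan_glued_mem uniq_start_corners)[y]; rewrite inE => /orP[/eqP->|/mapP[j _ ->]] [/= e1 e2].
  case/orP: st => /strip_gluedP[i [j [ij es et]]].
    by move: e1 e2; rewrite es /= => -[->]; rewrite /start_corner eqxx.
  by move: e1 ij; rewrite et /= => -[->].
by case/orP: st e1 => /strip_gluedP[i [k [_ es et]]]; rewrite ?es ?et.
Qed.

(** The strip has at least two triangles, so the cycles of triangles around its two ends are
    disjoint. *)
Lemma end_not_start s t u : sym_fan_glued ecs s t -> sym_fan_glued scs s u -> False.
Proof.
move=> /(sym_fan_glued_mem uniq_end_corners)[y]; rewrite inE => /orP[/eqP->|/mapP[j _ ->]] [/= e1 _];
move=> /(sym_fan_glued_mem uniq_start_corners)[z]; rewrite inE => /orP[/eqP->|/mapP[k _ ->]] [/= e2 _];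
by move: e1; rewrite e2 // => -[].
Qed.

Lemma strip_glued_fun s t1 t2 : strip_glued s t1 || strip_glued t1 s ->
  strip_glued s t2 || strip_glued t2 s -> t1 = t2.
Proof.
(* By [turn], the entry side of a triangle is not its exit side. *)
have asym (i j : 'I_n.+2) (k l : 'I_n.+2) : j = i.+1 :> nat -> l = k.+1 :> nat ->
    (inl j, (Defs.glue (d i)).2) = (inl k, (d k).2) :> P * 'I_3 -> False.
  move=> ji lk e; have [/= jk] := congr1 fst e; have /= := congr1 snd e.
  rewrite -jk ji; apply: turn; have := ltn_ord l; rewrite lk -jk ji; lia.
case/orP=> /strip_gluedP[i [j [ji e1 e2]]]; case/orP=> /strip_gluedP[k [l [lk f1 f2]]].
- have [/= ik] := etrans (esym (congr1 fst e1)) (congr1 fst f1).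
  by rewrite e2 f2 -ik; congr (inl _, _); apply/val_inj; rewrite /= ji lk ik.
- by case: (asym k l i j) => //; rewrite -e1 f2.
- by case: (asym i j k l) => //; rewrite -e2 f1.
- have [/= jl] := etrans (esym (congr1 fst e2)) (congr1 fst f2).
  have ik : i = k by apply/val_inj/eqP; rewrite -eqSS -ji -lk jl.
  by rewrite e1 f1 ik.
Qed.

Lemma polygon_glued_fun s t1 t2 : sym_glued s t1 -> sym_glued s t2 -> t1 = t2.
Proof.
case/sym_gluedP=> [h1|/andP[_ h1]|/andP[_ h1]]; case/sym_gluedP=> [h2|/andP[_ h2]|/andP[_ h2]].
- exact: strip_glued_fun h1 h2.
- by case: (strip_not_end h1 h2).
- by case: (strip_not_start h1 h2).
- by case: (strip_not_end h2 h1).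
- exact: sym_fan_glued_fun uniq_end_corners h1 h2.
- by case: (end_not_start h1 h2).
- by case: (strip_not_start h2 h1).
- by case: (end_not_start h2 h1).
- exact: sym_fan_glued_fun uniq_start_corners h1 h2.
Qed.

(* The vertex of the [j.+1]-st triangle that is not on its side of entry gets
   the new label [j.+1], except that, when the only triangle at the end puncture
   is the last triangle of the strip, folded onto itself, the two ends of the
   last diagonal of the strip are the same vertex and need equal labels. *)
Fixpoint strip_label (i : nat) (v : 'I_3) : nat :=
  if i is j.+1 then
    let a := (Defs.glue (d j)).2 in
    let old w := if w == a + 1 then strip_label j ((d j).2 + 2)
                 else strip_label j ((d j).2 + 1) in
    if v != a then old v
    else if [&& bp, mp == 0%N & j.+1 == n] then
      old (if (d n).2 == a + 1 then a + 2 else a + 1)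
    else j.+1
  else 0%N.

Lemma strip_label_le i v : (strip_label i v <= i)%N.
Proof.
elim: i v => [|i IH] v //=.
by do ![case: ifP => // _]; rewrite leqW.
Qed.

(** The folded triangle inherits the labels at the ends of the last diagonal. These are equal by the
    exceptional clause of [strip_label], or because triangle 0 only has the label 0 if [n] is 0. *)
Lemma strip_label_loop : bp -> mp = 0%N ->
  strip_label n.+1 ((end_corner n d).2 + 1) = strip_label n.+1 ((end_corner n d).2 + 2).
Proof.
move=> hb hm; have -> : (end_corner n d).2 = (Defs.glue (d n)).2 by [].
rewrite /= !I3_neqE /= eqxx.
suff H k : k = n -> strip_label k ((d k).2 + 2) = strip_label k ((d k).2 + 1) by exact: H.
case: k => [|j] jn //=; rewrite hm hb jn eqxx -jn /=.
(* By [turn], the last diagonal is one of the two sides at the new vertex. *)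
have /eqP : (Defs.glue (d j)).2 <> (d j.+1).2 by apply: turn; rewrite -jn.
set a := (Defs.glue _).2; set b := (d j.+1).2 => nab.
have [ba|ba|ba] := I3_cases a b; first by rewrite ba eqxx in nab.
  by rewrite ba !I3_addE ?I3_neqE ?eqxx /= ?I3_neqE ?eqxx.
by rewrite ba !I3_addE ?I3_neqE ?eqxx /= ?I3_neqE ?eqxx.
Qed.

(** * Ranks and vertex labels of the polygon *)

Definition polygon_rank (t : P) : nat :=
  match (t : polygon_tri n d bp bq) with
  | inl i => i
  | inr (inl k) => n.+2 + k
  | inr (inr k) => n.+2 + mp + k
  end.

(** The offsets [n.+2] and [n.+2 + mp] are the ranks at which the two fans start, so a new outer
    vertex is labelled by the rank of the triangle introducing it. *)
Definition polygon_label (y : P * 'I_3) : nat :=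
  match (y.1 : polygon_tri n d bp bq) with
  | inl i => strip_label i y.2
  | inr (inl k) => fan_label (strip_label n.+1) n.+2 mp (end_corner n d).2
      (nth (end_corner n d) (fan (end_corner n d)) k).2 k y.2
  | inr (inr k) => fan_label (strip_label 0) (n.+2 + mp) mq (start_corner d).2
      (nth (start_corner d) (fan (start_corner d)) k).2 k y.2
  end.

Lemma polygon_rank_inj : injective polygon_rank.
Proof.
move=> [i|[k|k]] [j|[l|l]] /= e.
- by congr (inl _); apply/val_inj.
- by have := ltn_ord i; lia.
- by have := ltn_ord i; lia.
- by have := ltn_ord j; lia.
- by congr (inr (inl _)); apply/val_inj => /=; lia.
- by have := ltn_ord k; lia.
- by have := ltn_ord j; lia.
- by have := ltn_ord l; lia.
- by congr (inr (inr _)); apply/val_inj => /=; lia.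
Qed.

Lemma fan_label_le (L : 'I_3 -> nat) (b m : nat) (x y : 'I_3) (k : nat) (v : 'I_3) :
  (forall w, L w <= b)%N -> (fan_label L b m x y k v <= b + k)%N.
Proof.
move=> Lb; have Lbk w : (L w <= b + k)%N := leq_trans (Lb w) (leq_addr _ _).
rewrite /fan_label; do 2!case: ifP => // _; last by case: ifP.
by case: k Lbk => // k _; rewrite leq_add2l.
Qed.

Lemma polygon_label_le y : (polygon_label y <= polygon_rank y.1)%N.
Proof.
case: y => -[i|[k|k]] v; rewrite /polygon_label /polygon_rank /=.
- exact: strip_label_le.
- by apply: fan_label_le => w; apply: leq_trans (strip_label_le n.+1 w) _.
- exact: fan_label_le.
Qed.

Lemma size_end_corners : size (behead ecs) = mp.
Proof. by rewrite /= size_map size_enum_ord. Qed.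

Lemma size_start_corners : size (behead scs) = mq.
Proof. by rewrite /= size_map size_enum_ord. Qed.

Lemma nth_end_corners (x : P * 'I_3) k (kc : (k < mp)%N) :
  nth x (behead ecs) k =
  (inr (inl (Ordinal kc)), (nth (end_corner n d) (fan (end_corner n d)) k).2).
Proof.
rewrite /= (nth_map (Ordinal kc)) ?size_enum_ord //.
by rewrite (_ : nth _ _ k = Ordinal kc) //; apply/val_inj; rewrite /= nth_enum_ord.
Qed.

Lemma nth_start_corners (x : P * 'I_3) k (kc : (k < mq)%N) :
  nth x (behead scs) k =
  (inr (inr (Ordinal kc)), (nth (start_corner d) (fan (start_corner d)) k).2).
Proof.
rewrite /= (nth_map (Ordinal kc)) ?size_enum_ord //.
by rewrite (_ : nth _ _ k = Ordinal kc) //; apply/val_inj; rewrite /= nth_enum_ord.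
Qed.

Let end0 : P * 'I_3 := (inl ord_max, (end_corner n d).2).
Let start0 : P * 'I_3 := (inl ord0, (start_corner d).2).

Lemma end_label (k : nat) (v : 'I_3) : (k < size (behead ecs))%N ->
  polygon_label ((nth end0 (behead ecs) k).1, v) =
  fan_label (fun w => polygon_label (end0.1, w)) n.+2 (size (behead ecs)) end0.2
    (nth end0 (behead ecs) k).2 k v.
Proof.
by rewrite size_end_corners => kc; rewrite (nth_end_corners end0 kc).
Qed.

Lemma start_label (k : nat) (v : 'I_3) : (k < size (behead scs))%N ->
  polygon_label ((nth start0 (behead scs) k).1, v) =
  fan_label (fun w => polygon_label (start0.1, w)) (n.+2 + mp) (size (behead scs)) start0.2
    (nth start0 (behead scs) k).2 k v.
Proof.
by rewrite size_start_corners => kc; rewrite (nth_start_corners start0 kc).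
Qed.

Lemma polygon_label_glued s t : glued s t ->
  polygon_label (s.1, s.2 + 1) = polygon_label (t.1, t.2 + 2) /\
  polygon_label (s.1, s.2 + 2) = polygon_label (t.1, t.2 + 1).
Proof.
case/or3P=> [/strip_gluedP[i [j [ij -> ->]]]|/andP[hb]|/andP[hb]].
- by rewrite /polygon_label /= ij /= !I3_neqE /= eqxx.
- apply: (fan_glued_label uniq_end_corners (b := n.+2) end_label).
  by rewrite size_end_corners => m0; apply: strip_label_loop.
- exact: (fan_glued_label uniq_start_corners (b := n.+2 + mp) start_label).
Qed.

Lemma polygon_label_vertex s t : vertex s = vertex t -> polygon_label s = polygon_label t.
Proof.
move/eq_vertexP/connectP=> [p]; elim: p s => [|u p IH] s /=; first by move=> _ ->.
case/andP=> /existsP[x /existsP[y /andP[g h]]] up tl; rewrite -(IH u) // {p IH up tl t}.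
have [e1 e2] : polygon_label (x.1, x.2 + 1) = polygon_label (y.1, y.2 + 2) /\
    polygon_label (x.1, x.2 + 2) = polygon_label (y.1, y.2 + 1).
  by case/orP: g => /polygon_label_glued[].
by case/orP: h => /andP[/eqP-> /eqP->].
Qed.

(** With an empty fan the corner is its own cyclic successor: the two sides at the puncture are
    glued together, which identifies the ends of the third. *)
Lemma end_loop : bp -> mp = 0%N ->
  vertex ((inl ord_max, (end_corner n d).2 + 1) : P * 'I_3) =
  vertex ((inl ord_max, (end_corner n d).2 + 2) : P * 'I_3).
Proof.
move=> hb m0; set a := (end_corner n d).2.
have g : sym_glued ((inl ord_max, a + 1) : P * 'I_3) (inl ord_max, a + 2).
  apply/orP; left; apply/or3P; constructor 2; apply/andP; split=> //.
  apply/(fan_gluedP end0 _ _ uniq_end_corners); exists 0%N.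
  have sz : size ecs = 1%N := congr1 S (etrans size_end_corners m0).
  by rewrite /cyc_succ sz.
by have /= := sym_glued_vertex1 g; rewrite !I3_addE.
Qed.

Lemma polygon_removable (t : P) : removable polygon_rank t.
Proof.
case: t => [i|[k|k]].
- case: i => -[|i] ilt; first by constructor 1 => j y _.
  pose i' : 'I_n.+2 := Ordinal (ltnW ilt); pose i1 : 'I_n.+2 := Ordinal ilt.
  have g : sym_glued ((inl i1, (Defs.glue (d i)).2) : P * 'I_3) (inl i', (d i).2).
    by rewrite sym_gluedC; apply/orP; left; apply/or3P; constructor 1; rewrite /strip_glued /= !eqxx.
  constructor 2; exists (Defs.glue (d i)).2, (inl i', (d i).2); split=> //.
  have [/and3P[hb /eqP m0 /eqP iN]|alias] := boolP [&& bp, mp == 0%N & i.+1 == n]; last first.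
    (* The corner opposite to the entry side carries a new label, equal to the rank, hence is
       free. *)
    constructor 1 => y /polygon_label_vertex yv.
    apply: leq_trans (polygon_label_le y); rewrite -yv.
    by rewrite /polygon_label /= eqxx (negbTE alias).
  (* The next triangle is folded, so the last diagonal is a loop; by [turn] it joins the vertex
     opposite to the entry side to an end of that side. *)
  have g' : sym_glued ((inl i1, (d i.+1).2) : P * 'I_3) (inl ord_max, (end_corner n d).2).
    apply/orP; left; apply/or3P; constructor 1.
    by rewrite /strip_glued /= iN !eqxx.
  have loop : vertex ((inl i1, (d i.+1).2 + 1) : P * 'I_3) =
      vertex ((inl i1, (d i.+1).2 + 2) : P * 'I_3).
    by rewrite (sym_glued_vertex1 g') (sym_glued_vertex2 g') end_loop.
  have /eqP : (Defs.glue (d i)).2 <> (d i.+1).2 by apply: turn; rewrite -iN.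
  move: loop; case: (I3_cases (Defs.glue (d i)).2 (d i.+1).2) => ->; rewrite ?eqxx // !I3_addE => loop _.
    by constructor 3.
  by constructor 2.
- have kc : (k < size (behead ecs))%N by rewrite size_end_corners.
  have := nth_end_corners end0 (ltn_ord k).
  rewrite (_ : Ordinal _ = k); last exact/val_inj.
  move/(congr1 fst) => /= <-.
  apply: (fan_removable uniq_end_corners (b := n.+2) end_label) => //.
  + by move=> l; rewrite size_end_corners => lc; rewrite (nth_end_corners end0 lc).
  + exact: polygon_label_le.
  + exact: polygon_label_vertex.
  + move=> s t st; apply/orP; left; apply/or3P; constructor 2; rewrite st andbT.
    exact: fan_size_gt (ltn_ord k).
- have kc : (k < size (behead scs))%N by rewrite size_start_corners.
  have := nth_start_corners start0 (ltn_ord k).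
  rewrite (_ : Ordinal _ = k); last exact/val_inj.
  move/(congr1 fst) => /= <-.
  apply: (fan_removable uniq_start_corners (b := n.+2 + mp) start_label) => //.
  + by move=> l; rewrite size_start_corners => lc; rewrite (nth_start_corners start0 lc).
  + exact: polygon_label_le.
  + exact: polygon_label_vertex.
  + move=> s t st; apply/orP; left; apply/or3P; constructor 3; rewrite st andbT.
    exact: fan_size_gt (ltn_ord k).
Qed.

Lemma polygon_symdiff_matchings (E F : {set bedge P}) :
  perfect_matching E -> perfect_matching F ->
  exists Q : {set {set bedge P}}, Q \subset squares P /\ symdiff E F = boundary_edges Q.
Proof.
move=> hE hF.
have [Q Qg EFQ] := even_subgraph_span polygon_rank_inj polygon_removable
  (even_subgraph_matchings hE hF).
exists Q; split; first exact: fintype.subset_trans Qg (good_squares_sub P).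
by rewrite boundary_edgesE //; apply: polygon_glued_fun.
Qed.

End PolygonSquares.

(** * From matchings of angles to matchings of the graph *)

Lemma card_unique_fibers (T U : finType) (f : T -> U) (A : {set T}) (B : {set U}) :
  (forall x, x \in A -> f x \in B) ->
  (forall u, u \in B -> #|[set x in A | f x == u]%SET| = 1%N) -> #|A| = #|B|.
Proof.
move=> fAB f1; rewrite -sum1_card (partition_big f (mem B)) //= -[RHS]sum1_card.
by apply: eq_bigr => u uB; rewrite -[RHS](f1 u uB) -sum1dep_card.
Qed.

Section AnglesOfMatchings.
Variable P : tri_complex.
Implicit Types (A : {set P * 'I_3}) (E : {set bedge P}).

Lemma black_vertexP (v : {set P * 'I_3}) x : v \in black_vertices P -> x \in v -> v = vertex x.
Proof. by rewrite inE => /andP[vP _]; apply: vertexP. Qed.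

Lemma black_angles A v : v \in black_vertices P ->
  [set x in A | vertex x == v]%SET = A :&: v.
Proof.
move=> bv; apply/setP=> x; rewrite !inE; congr (_ && _).
by apply/eqP/idP => [<-|/(black_vertexP bv)//]; exact: mem_vertex.
Qed.

(* A perfect matching exists only if there are as many black as white vertices;
   this leaves no room for angles at the other vertices. *)
Lemma angle_matching_black A E : angle_matching A -> perfect_matching E ->
  forall x, x \in A -> vertex x \in black_vertices P.
Proof.
move=> [bA wA] [/fintype.subsetP sE bE wE].
have EP : #|E| = #|[set: P]%SET| by apply: (card_unique_fibers (f := snd)) => [e|t]; rewrite ?inE.
have EB : #|E| = #|black_vertices P|.
  by apply: (card_unique_fibers (f := fst)) => [e /sE|]; rewrite ?inE => // /andP[].
have AP : #|A| = #|[set: P]%SET| by apply: (card_unique_fibers (f := fst)) => [x|t]; rewrite ?inE.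
pose A' := [set x in A | vertex x \in black_vertices P]%SET.
have A'B : #|A'| = #|black_vertices P|.
  apply: (card_unique_fibers (f := @vertex P)) => [x|v bv]; first by rewrite inE => /andP[].
  apply: etrans (bA v bv); rewrite -black_angles //; apply: eq_card => x; rewrite !inE.
  by case: eqVneq => [->|_]; rewrite ?andbF //; move: bv; rewrite inE => ->; rewrite !andbT.
have AA' : A' = A.
  apply/eqP; rewrite eqEcard A'B -EB EP AP leqnn andbT.
  by apply/fintype.subsetP=> x; rewrite inE => /andP[].
by move=> x; rewrite -AA' inE => /andP[].
Qed.

(** [matching_of_angles] only keeps angles at black vertices; by [angle_matching_black] these are
    all of them, so every triangle retains its edge. *)
Lemma perfect_matching_of_angles A E : angle_matching A -> perfect_matching E ->
  perfect_matching (matching_of_angles A).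
Proof.
move=> hA hE; have black := angle_matching_black hA hE; case: hA => bA wA.
have ME : matching_of_angles A = [set varpi x | x in A]%SET.
  apply/setP=> e; apply/imsetP/imsetP => -[x xA ->]; exists x => //.
    by move: xA; rewrite inE => /andP[].
  by rewrite inE xA black.
rewrite ME; split.
- apply/fintype.subsetP=> _ /imsetP[x xA ->]; rewrite inE black //=.
  by apply/existsP; exists x; rewrite mem_vertex /=.
- move=> v bv; have /eqP/cards1P[x Ax] := bA v bv.
  rewrite (_ : [set _ | _]%SET = [set varpi x]%SET) ?cards1 //.
  have := Ax; rewrite -black_angles // => /setP Ax'.
  apply/setP=> e; rewrite !inE; apply/andP/eqP => [[/imsetP[y yA ->] yv]|->].
    by have := Ax' y; rewrite !inE yA yv => /esym/eqP->.
  have := Ax' x; rewrite !inE eqxx => /andP[xA xv].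
  by split=> //; apply/imsetP; exists x.
- move=> t; have /eqP/cards1P[x /setP Ax'] := wA t.
  rewrite (_ : [set _ | _]%SET = [set varpi x]%SET) ?cards1 //.
  apply/setP=> e; rewrite !inE; apply/andP/eqP => [[/imsetP[y yA ->] yv]|->].
    by have := Ax' y; rewrite !inE yA yv => /esym/eqP->.
  have := Ax' x; rewrite !inE eqxx => /andP[xA xv].
  by split=> //; apply/imsetP; exists x.
Qed.

End AnglesOfMatchings.

Theorem proposition1p6 (R : realType) (S : riemann_surface R) (M : set S)
  (hSM : marked_surface M)
  (T : set (tarc S)) (hT : tagged_triangulation M T) (hA1 : condA1 M T)
  (delta : tarc S) (hdelta : tagged_arc M delta)
  (hnotin : ~ T (delta.1, set0)) (hA2 : condA2 M T delta)
  (K : gluing) (phi : K -> cplx R -> S) (hphi : realizes M T phi)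
  (c : R -> S) (hc : simple_curve M c)
  (hcdelta : isotopic M delta.1 (curve_image c))
  (n : nat) (d : nat -> K * 'I_3) (hcross : crosses phi c n d)
  (A_ : {set tagged_polygon delta c n d * 'I_3})
  (hA_ : minimal_angle_matching A_)
  (E : {set bedge (tagged_polygon delta c n d)})
  (hE : perfect_matching E) :
  exists Q : {set {set bedge (tagged_polygon delta c n d)}},
    Q \subset squares (tagged_polygon delta c n d) /\
    symdiff (matching_of_angles A_) E = boundary_edges Q.
Proof.
have turn i : (i < n)%N -> (Defs.glue (d i)).2 <> (d i.+1).2.
  by case: hcross => t [sigma [_ [_ _ h] _ _ _]]; apply: h.
apply: (polygon_symdiff_matchings turn) => //.
by apply: perfect_matching_of_angles hE; case: hA_.
Qed.
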